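(* Let $G$ be a finite simple graph that contains none of $P_2+P_3$, $\overline{P_2+P_3}$, $K_{2,3}$ as an induced subgraph, and suppose $G$ contains an induced banner. Then $G$ is a good graph.
   Context: $P_2+P_3$ is the disjoint union of a two-vertex path and a three-vertex path, $\overline{P_2+P_3}$ its complement; $K_{2,3}$ is the complete bipartite graph with parts of sizes 2 and 3. A banner is the 5-vertex graph consisting of a chordless 4-cycle $v_1v_2v_3v_4$ together with one further vertex adjacent to exactly one vertex of the cycle. $\chi$, $\omega$ denote chromatic and clique number, $N(v)$ the neighbourhood and $d(v)=|N(v)|$. Two vertices are comparable if they are nonadjacent and the neighbourhood of one is contained in that of the other. A universal vertex is adjacent to all other vertices. A vertex $v$ is nice if $d(v)\leq\omega(G)+2$. $G$ is nice if it has three pairwise disjoint stable sets $S_1,S_2,S_3$ with $\omega(G-(S_1\cup S_2\cup S_3))\leq\omega(G)-2$. $G$ is good if at least one holds: (a) $G$ has a pair of comparable vertices; (b) $G$ has a universal vertex; (c) $G$ has a nice vertex; (d) $G$ is nice; (e) $\chi(G)\leq\omega(G)+3$. *)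

(* Defs.v *)
From mathcomp Require Import all_boot.

Set Implicit Arguments.
Unset Strict Implicit.
Unset Printing Implicit Defensive.

Record sgraph := SGraph {
  vertex :> finType;
  adj : rel vertex;
  adj_sym : symmetric adj;
  adj_irr : irreflexive adj }.

Definition contains_induced (G H : sgraph) : Prop :=
  exists2 f : H -> G, injective f & forall x y : H, adj (f x) (f y) = adj x y.

Section Invariants.
Variable G : sgraph.

Definition nbhd (v : G) : {set G} := [set w | adj v w].
Definition deg (v : G) : nat := #|nbhd v|.

Definition clique (A : {set G}) : bool :=
  [forall x in A, forall y in A, (x != y) ==> adj x y].
Definition stable (A : {set G}) : bool :=
  [forall x in A, forall y in A, ~~ adj x y].

Definition omega : nat := \max_(A : {set G} | clique A) #|A|.

Definition colorable (k : nat) : bool :=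
  [exists f : {ffun G -> 'I_k}, forall x, forall y, adj x y ==> (f x != f y)].

Lemma ex_colorable : exists k, colorable k.
Proof.
exists #|G|; apply/existsP; exists [ffun x => enum_rank x].
apply/forallP => x; apply/forallP => y; apply/implyP => xy.
by rewrite !ffunE (inj_eq enum_rank_inj); apply: contraTneq xy => ->; rewrite adj_irr.
Qed.

Definition chi : nat := ex_minn ex_colorable.

End Invariants.

Section Induced.
Variables (G : sgraph) (A : {set G}).

Definition induced_adj : rel {x : G | x \in A} :=
  fun x y => adj (val x) (val y).

Lemma induced_sym : symmetric induced_adj.
Proof. by move=> x y; apply: adj_sym. Qed.

Lemma induced_irr : irreflexive induced_adj.
Proof. by move=> x; apply: adj_irr. Qed.

Definition induced : sgraph := SGraph induced_sym induced_irr.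
End Induced.

Section Complement.
Variable G : sgraph.

Definition compl_adj : rel G := fun x y => (x != y) && ~~ adj x y.

Lemma compl_sym : symmetric compl_adj.
Proof. by move=> x y; rewrite /compl_adj eq_sym adj_sym. Qed.

Lemma compl_irr : irreflexive compl_adj.
Proof. by move=> x; rewrite /compl_adj eqxx. Qed.

Definition compl : sgraph := SGraph compl_sym compl_irr.
End Complement.

Section DisjointUnion.
Variables G H : sgraph.

Definition union_adj : rel (G + H)%type := fun x y =>
  match x, y with
  | inl a, inl b => adj a b
  | inr a, inr b => adj a b
  | _, _ => false
  end.

Lemma union_sym : symmetric union_adj.
Proof. by case=> x [] y //=; apply: adj_sym. Qed.

Lemma union_irr : irreflexive union_adj.
Proof. by case=> x /=; apply: adj_irr. Qed.

Definition disjoint_union : sgraph := SGraph union_sym union_irr.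
End DisjointUnion.

Section PathGraph.
Variable n : nat.

Definition path_adj : rel 'I_n := fun i j => (i.+1 == j :> nat) || (j.+1 == i :> nat).

Lemma path_sym : symmetric path_adj.
Proof. by move=> i j; rewrite /path_adj orbC. Qed.

Lemma path_irr : irreflexive path_adj.
Proof. by move=> i; rewrite /path_adj orbb gtn_eqF. Qed.

Definition path_graph : sgraph := SGraph path_sym path_irr.
End PathGraph.

Section CompleteBipartite.
Variables m n : nat.

Definition bip_adj : rel ('I_m + 'I_n)%type := fun x y =>
  match x, y with
  | inl _, inr _ | inr _, inl _ => true
  | _, _ => false
  end.

Lemma bip_sym : symmetric bip_adj.
Proof. by case=> x [] y. Qed.

Lemma bip_irr : irreflexive bip_adj.
Proof. by case. Qed.

Definition complete_bipartite : sgraph := SGraph bip_sym bip_irr.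
End CompleteBipartite.

(* Some i is the cycle vertex v_(i+1); None is the pendant vertex, attached to
   v_1. *)
Definition banner_adj : rel (option 'I_4) := fun x y =>
  match x, y with
  | Some i, Some j => (i.+1 %% 4 == j) || (j.+1 %% 4 == i)
  | Some i, None | None, Some i => i == ord0
  | None, None => false
  end.

Lemma banner_sym : symmetric banner_adj.
Proof. by case=> [i|] [j|] //=; rewrite orbC. Qed.

Lemma banner_irr : irreflexive banner_adj.
Proof. by case=> [[[|[|[|[|[]]]]] //]|]. Qed.

Definition banner : sgraph := SGraph banner_sym banner_irr.

Definition P2_P3 : sgraph := disjoint_union (path_graph 2) (path_graph 3).

Section Good.
Variable G : sgraph.

Definition comparable_vertices (x y : G) : Prop :=
  [/\ x != y, ~~ adj x y &
      (nbhd x \subset nbhd y) || (nbhd y \subset nbhd x)].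

Definition universal (v : G) : Prop := forall w : G, w != v -> adj v w.

Definition nice_vertex (v : G) : Prop := deg v <= omega G + 2.

(* omega (G - S) <= omega G - 2 over the integers: stated additively since
   subtraction on nat is truncated. *)
Definition nice_graph : Prop :=
  exists S1 S2 S3 : {set G},
    [/\ stable S1, stable S2 & stable S3] /\
    [/\ [disjoint S1 & S2], [disjoint S1 & S3] & [disjoint S2 & S3]] /\
    omega (induced (~: (S1 :|: S2 :|: S3))) + 2 <= omega G.

Definition good : Prop :=
  (exists x y : G, comparable_vertices x y) \/
  (exists v : G, universal v) \/
  (exists v : G, nice_vertex v) \/
  nice_graph \/
  chi G <= omega G + 3.

End Good.

(* Main.v *)
(** Fix an induced 4-cycle [v1 v2 v3 v4] with a pendant vertex [x] at [v1], and
    sort the other vertices by their neighbours on the cycle: [Z] (none), [A_i]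
    (only [v_i]), [B_i] ([v_i] and [v_(i+1)]) and [D] (all four); no other
    pattern occurs.  The set [{v2, v4} + A_1 + Z] is stable, and [D] is the
    complement of a matching, so [D] needs at most [omega - 2] colours.  Hence
    [chi <= omega + 3] as soon as the residual graph on
    [{v1, v3} + A_2 + A_3 + A_4 + B_1 + ... + B_4] is 4-colourable.

    If [A_3] is empty, [x] has at most one neighbour in [A_2 + B_2] and one in
    [A_4 + B_3].  So either the neighbours of [x] in [B_1 + B_4 + D] form a
    clique up to one vertex, and [x] is nice, or they contain two disjoint
    nonadjacent pairs or a stable triple.  In the latter case [B_2 + B_3] has at
    most two vertices, whence [v3] is nice if [D] is a clique; if [D] is not a
    clique, then either two opposite cycle vertices are comparable or the
    residual graph has boundedly many vertices and is 4-colourable.  If [A_3]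
    is not empty, then [v1] or [v3] is nice or the residual graph is
    4-colourable.

    The bounded configurations are settled by exhaustive enumeration: one lists
    all ways of adding vertices of given types, one at a time, without creating
    a forbidden five-vertex subgraph. *)

Require Import Defs.
From mathcomp Require Import all_boot.
Set Implicit Arguments.
Unset Strict Implicit.
Unset Printing Implicit Defensive.

(** * The forbidden five-vertex graphs as bit strings *)

Inductive btree := Leaf of bool | Node of btree & btree.

Fixpoint lookup (t : btree) (m : bitseq) : bool :=
  match t, m with
  | Leaf b, _ => b
  | Node l r, b :: m' => if b then lookup l m' else lookup r m'
  | Node _ _, [::] => false
  end.

(** All-false subtrees collapse, so a prefix that no forbidden string continues is recognised at
    once. *)
Fixpoint build (n : nat) (f : bitseq -> bool) : btree :=
  if n is n'.+1 then
    match build n' (fun m => f (true :: m)), build n' (fun m => f (false :: m)) with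
    | Leaf false, Leaf false => Leaf false
    | l, r => Node l r
    end
  else Leaf (f [::]).

Lemma lookup_build n f m : size m = n -> lookup (build n f) m = f m.
Proof.
elim: n f m => [|n IH] f [|b m] //= [] /[dup] /IH H1 /IH H2.
have {H1} := H1 (fun m => f (true :: m)); have {H2} := H2 (fun m => f (false :: m)).
by case: (build _ _) => [[]|? ?]; case: (build _ _) => [[]|? ?] /=; case: b => /=.
Qed.

Section Encoding.
Variables (T : Type) (e : rel T).

(* The entries of one vertex towards its successors come last, so that a prefix
   of the string describes the subgraph on the final vertices of [s]. *)
Fixpoint adj_bits (s : seq T) : bitseq :=
  if s is a :: s' then adj_bits s' ++ [seq e b a | b <- s'] else [::].
End Encoding.

Definition edges_rel (E : seq (nat * nat)) : rel nat :=
  fun i j => ((i, j) \in E) || ((j, i) \in E).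

Definition P2P3_rel := edges_rel [:: (0, 1); (2, 3); (3, 4)].
Definition coP2P3_rel : rel nat := fun i j => (i != j) && ~~ P2P3_rel i j.
Definition K23_rel :=
  edges_rel [:: (0, 2); (0, 3); (0, 4); (1, 2); (1, 3); (1, 4)].

Definition forbidden_rel (k : nat) : rel nat :=
  nth P2P3_rel [:: P2P3_rel; coP2P3_rel; K23_rel] k.

(** All orderings of the five vertices are listed, so the test is independent of how a subgraph is
    enumerated. *)
Definition forbidden_masks : seq bitseq :=
  undup [seq adj_bits (forbidden_rel k) p | k <- iota 0 3, p <- permutations (iota 0 5)].

Definition bad_masks : seq bitseq := Eval vm_compute in forbidden_masks.

Lemma bad_masksE : forbidden_masks = bad_masks.
Proof. by vm_compute. Qed.

Definition bad_tree : btree :=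
  Eval vm_compute in build 10 (fun m => m \in bad_masks).

Lemma bad_treeE m : size m = 10 -> lookup bad_tree m = (m \in forbidden_masks).
Proof.
move=> m_sz; rewrite bad_masksE.
rewrite -(@lookup_build 10 (fun m => m \in bad_masks) m m_sz).
suff -> : build 10 (fun m => m \in bad_masks) = bad_tree by [].
by vm_compute.
Qed.

(** A vertex of [H] labelled [h i] goes to the entry of [s] at the position of that label in [p];
    ten bits fix all adjacencies by symmetry and irreflexivity. *)
Lemma adj_bits_contains (G H : sgraph) (h : H -> nat) (e : rel nat) (s : seq G) p :
  injective h -> (forall i, h i < 5) ->
  (forall i j, adj i j = e (h i) (h j)) -> symmetric e -> irreflexive e ->
  size s = 5 -> uniq s -> perm_eq p (iota 0 5) ->
  adj_bits (@adj G) s = adj_bits e p -> contains_induced G H.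
Proof.
move=> h_inj h_lt hE e_sym e_irr; case: s => [|a [|b [|c [|d [|f [|]]]]]] // _ s_uniq p_iota.
have p_sz : size p = 5 by rewrite (perm_size p_iota).
have p_mem i : (h i) \in p by rewrite (perm_mem p_iota) mem_iota add0n h_lt.
have idx_lt i : index (h i) p < 5 by rewrite -p_sz index_mem.
case: p p_sz p_iota p_mem idx_lt => [|p0 [|p1 [|p2 [|p3 [|p4 [|]]]]]] //= _ _ p_mem idx_lt.
set p := [:: p0; p1; p2; p3; p4] in p_mem idx_lt *; set s := [:: a; b; c; d; f] in s_uniq *.
move=> [] e1 e2 e3 e4 e5 e6 e7 e8 e9 e10.
have sE i j : i < 5 -> j < 5 -> adj (nth a s i) (nth a s j) = e (nth 0 p i) (nth 0 p j).
  by case: i => [|[|[|[|[|i]]]]] //; case: j => [|[|[|[|[|j]]]]] //= _ _;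
    rewrite ?adj_irr ?e_irr // ?e1 ?e2 ?e3 ?e4 ?e5 ?e6 ?e7 ?e8 ?e9 ?e10 //;
    rewrite adj_sym e_sym ?e1 ?e2 ?e3 ?e4 ?e5 ?e6 ?e7 ?e8 ?e9 ?e10.
exists (fun i => nth a s (index (h i) p)) => [i j|i j].
  move/eqP; rewrite nth_uniq ?idx_lt // => /eqP ij.
  by apply: h_inj; rewrite -(nth_index 0 (p_mem i)) ij nth_index.
by rewrite sE ?idx_lt // !nth_index.
Qed.

Lemma sym_edges E : symmetric (edges_rel E).
Proof. by move=> i j; rewrite /edges_rel orbC. Qed.

Definition sum_code m n (i : 'I_m + 'I_n) : nat :=
  match i with inl k => k | inr k => m + k end.

Lemma sum_code_inj m n : injective (@sum_code m n).
Proof.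
move=> [i|i] [j|j] /= => [/val_inj->//|ij|ij|/addnI/val_inj->//].
  by have := ltn_ord i; rewrite ij ltnNge leq_addr.
by have := ltn_ord j; rewrite -ij ltnNge leq_addr.
Qed.

Lemma sum_code_lt m n (i : 'I_m + 'I_n) : sum_code i < m + n.
Proof. by case: i => i /=; rewrite ?ltn_add2l // ltn_addr. Qed.

Definition bad5free (G : sgraph) : Prop :=
  forall s : seq G, size s = 5 -> uniq s -> lookup bad_tree (adj_bits (@adj G) s) = false.

Lemma bad5freeP (G : sgraph) :
  ~ contains_induced G P2_P3 -> ~ contains_induced G (compl P2_P3) ->
  ~ contains_induced G (complete_bipartite 2 3) -> bad5free G.
Proof.
move=> noP noC noK s s_sz s_uniq; rewrite bad_treeE; last first.
  by case: s s_sz {s_uniq} => [|a [|b [|c [|d [|f [|]]]]]].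
apply/negbTE/negP; rewrite mem_undup => /allpairsP[[k p] /= [k_in]].
rewrite mem_permutations => p_iota sE.
have irr E : all (fun ij => ij.1 != ij.2) E -> irreflexive (edges_rel E).
  by move=> /allP Eirr i; rewrite /edges_rel orbb; apply/negP => /Eirr /=; rewrite eqxx.
move: k_in sE; rewrite !inE => /or3P[] /eqP-> sE.
- apply: noP; apply: (@adj_bits_contains G P2_P3 (@sum_code 2 3) P2P3_rel s p) => //.
  + exact: sum_code_inj.
  + exact: sum_code_lt.
  + by move=> [[[|[|?]] ?]|[[|[|[|?]]] ?]] [[[|[|?]] ?]|[[|[|[|?]]] ?]].
  + exact: sym_edges.
  + exact: irr.
- apply: noC; apply: (@adj_bits_contains G (compl P2_P3) (@sum_code 2 3) coP2P3_rel s p) => //.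
  + exact: sum_code_inj.
  + exact: sum_code_lt.
  + by move=> [[[|[|?]] ?]|[[|[|[|?]]] ?]] [[[|[|?]] ?]|[[|[|[|?]]] ?]].
  + by move=> i j; rewrite /coP2P3_rel eq_sym; congr (_ && ~~ _); apply: sym_edges.
  + by move=> i; rewrite /coP2P3_rel eqxx.
- apply: noK.
  apply: (@adj_bits_contains G (complete_bipartite 2 3) (@sum_code 2 3) K23_rel s p) => //.
  + exact: sum_code_inj.
  + exact: sum_code_lt.
  + by move=> [[[|[|?]] ?]|[[|[|[|?]]] ?]] [[[|[|?]] ?]|[[|[|[|?]]] ?]].
  + exact: sym_edges.
  + exact: irr.
Qed.

(** * Enumeration of the extensions of a partial graph *)

(* A graph on a list of vertices, newest first: each vertex is stored with its
   adjacency to the 4-cycle and its adjacency to the older vertices.  The last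
   four vertices are the cycle itself. *)
Definition state := seq (bitseq * bitseq).

Definition child (t : btree) (b : bool) : btree :=
  if t is Node l r then if b then l else r else t.

(* [no_bad3], [no_bad2] and [no_bad1] run over the vertices [a], then [b], then
   [c] that complete the new vertex [n] and the vertex [u] to five vertices.
   Nested conditionals replace [&&], both arguments of which would be computed
   under call-by-value evaluation. *)
Fixpoint no_bad1 (t : btree) (rb ra ru rn : bitseq) : bool :=
  match rb, ra, ru, rn with
  | bc :: rb', ac :: ra', uc :: ru', nc :: rn' =>
    if lookup t [:: bc; ac; uc; nc] then false else no_bad1 t rb' ra' ru' rn'
  | _, _, _, _ => true
  end.

Fixpoint no_bad2 (t : btree) (st : state) (ra ru rn : bitseq) : bool :=
  match st, ra, ru, rn with
  | (_, rb) :: st', ab :: ra', ub :: ru', nb :: rn' =>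
    match child (child (child t ab) ub) nb with
    | Leaf false => no_bad2 t st' ra' ru' rn'
    | t' => if no_bad1 t' rb ra' ru' rn' then no_bad2 t st' ra' ru' rn' else false
    end
  | _, _, _, _ => true
  end.

Fixpoint no_bad3 (t : btree) (st : state) (ru rn : bitseq) : bool :=
  match st, ru, rn with
  | (_, ra) :: st', ua :: ru', na :: rn' =>
    if no_bad2 (child (child t ua) na) st' ra ru' rn' then no_bad3 t st' ru' rn' else false
  | _, _, _ => true
  end.

Definition agrees (o : option bool) (b : bool) : bool :=
  if o is Some b' then b == b' else true.

(** Only five-sets containing both the new vertex and the one with row [ru] are tested; those
    avoiding the latter were tested while [r] was built. *)
Definition grow_rows (o : option bool) (ru : bitseq) (st : state) (rs : seq bitseq) :=
  flatten [seq [seq b :: r | b <- [:: true; false] &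
     if agrees o b then no_bad3 (child bad_tree b) st ru r else false] | r <- rs].

(* Candidate rows of a new vertex; [kn] prescribes some of its adjacencies. *)
Fixpoint rows (st : state) (kn : seq (option bool)) : seq bitseq :=
  if st is (_, ru) :: st' then
    grow_rows (head None kn) ru st' (rows st' (behead kn))
  else [:: [::]].

(** [kn] concerns the newest vertices; the last four entries of a row face the cycle and are fixed
    by the type. *)
Definition pad (st : state) (t : bitseq) (kn : seq (option bool)) :=
  kn ++ nseq (size st - 4 - size kn) None ++ [seq Some b | b <- t].

Definition extend (t : bitseq) (kn : seq (option bool)) (k : state -> bool) (st : state) :=
  all (fun r => k ((t, r) :: st)) (rows st (pad st t kn)).

(* Adds a vertex with type in [ts] unless there is one already. *)
Definition extend_some (ts : seq bitseq) (k : state -> bool) (st : state) :=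
  if has (fun t => t \in ts) (unzip1 st) then k st else all (fun t => extend t [::] k st) ts.

(* Adds any number of vertices of type [t]; if more than [fuel] of them can be
   added, the answer is [false]. *)
Fixpoint extend_all (fuel : nat) (t : bitseq) (k : state -> bool) (st : state) : bool :=
  if k st then
    let rs := rows st (pad st t [::]) in
    if fuel is f.+1 then all (fun r => extend_all f t k ((t, r) :: st)) rs else nilp rs
  else false.

Definition extend_alls (fuel : nat) (ts : seq bitseq) (k : state -> bool) : state -> bool :=
  foldr (extend_all fuel) k ts.

Fixpoint has_nonedge (t : bitseq) (st : state) : bool :=
  if st is (t', r) :: st' then
    if (t' == t) && has (fun bt => ~~ bt.1 && (bt.2 == t)) (zip r (unzip1 st')) then true
    else has_nonedge t st'
  else false.

(* Adds whatever is missing of a nonadjacent pair of vertices of type [t]. *)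
Definition extend_nonedge (t : bitseq) (k : state -> bool) (st : state) : bool :=
  if has_nonedge t st then k st
  else all (fun i => if nth [::] (unzip1 st) i == t then
                       extend t (rcons (nseq i None) (Some false)) k st else true)
           (iota 0 (size st))
       && extend t [::] (extend t [:: Some false] k) st.

(** * Backtracking search for proper colourings of a state *)

Fixpoint conflict (c : nat) (r : bitseq) (cs : seq (option nat)) : bool :=
  match r, cs with
  | b :: r', o :: cs' =>
    if b then if o is Some c' then if c == c' then true else conflict c r' cs'
              else conflict c r' cs'
    else conflict c r' cs'
  | _, _ => false
  end.

Fixpoint some_colour (cols : seq nat) (f : nat -> bool) : bool :=
  if cols is c :: cols' then if f c then true else some_colour cols' f else false.

(** Passing the rest of the search as [k] lets a failure at a newer vertex backtrack to the older
    ones. *)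
Fixpoint colourings (cols : seq nat) (sl : bitseq -> bool) (st : state)
    (k : seq (option nat) -> bool) : bool :=
  if st is (t, r) :: st' then
    colourings cols sl st' (fun cs =>
      if sl t then
        some_colour cols (fun c => if conflict c r cs then false else k (Some c :: cs))
      else k (None :: cs))
  else k [::].

Definition colourable4 sl st := colourings (iota 0 4) sl st (fun=> true).

(* Types list the adjacencies to [v1], ..., [v4].  The cycle vertices [v1] and [v3]
   have type [tO], and [v2] and [v4] have type [tE]. *)
Definition tZ := [:: false; false; false; false].
Definition tA1 := [:: true; false; false; false].
Definition tA2 := [:: false; true; false; false].
Definition tA3 := [:: false; false; true; false].
Definition tA4 := [:: false; false; false; true].
Definition tB1 := [:: true; true; false; false].
Definition tB2 := [:: false; true; true; false].
Definition tB3 := [:: false; false; true; true].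
Definition tB4 := [:: true; false; false; true].
Definition tD := [:: true; true; true; true].
Definition tE := [:: true; false; true; false].
Definition tO := [:: false; true; false; true].

Definition base : state :=
  [:: (tO, [:: true; false; true]); (tE, [:: true; false]); (tO, [:: true]); (tE, [::])].

Definition residual (t : bitseq) := t \notin [:: tZ; tA1; tE; tD].

(** * Soundness of the enumeration *)

Lemma lookup_cat t m1 m2 : lookup t (m1 ++ m2) = lookup (foldl child t m1) m2.
Proof. by elim: m1 t => //= b m IH [c|l r] /=; rewrite -?IH //; case: b. Qed.

Section Soundness.
Variables (G : sgraph) (G_free : bad5free G) (v1 v2 v3 v4 : G).
Let bs := [:: v1; v2; v3; v4].

Definition vtype (u : G) : bitseq := [seq adj u v | v <- bs].

Fixpoint mat (s : seq G) : state :=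
  if s is u :: s' then (vtype u, [seq adj u v | v <- s']) :: mat s' else [::].

Lemma size_mat s : size (mat s) = size s.
Proof. by elim: s => //= u s ->. Qed.

Lemma unzip1_mat s : unzip1 (mat s) = map vtype s.
Proof. by elim: s => //= u s <-. Qed.

Lemma lookup_free (n u a b c : G) : uniq [:: c; b; a; u; n] ->
  lookup (foldl child bad_tree
           [:: adj n u; adj u a; adj n a; adj a b; adj u b; adj n b])
         [:: adj b c; adj a c; adj u c; adj n c] = false.
Proof. by move=> s_uniq; rewrite -lookup_cat; apply: G_free s_uniq. Qed.

Lemma no_bad1_mat (n u a b : G) s : uniq [:: n, u, a, b & s] ->
  no_bad1 (foldl child bad_tree [:: adj n u; adj u a; adj n a; adj a b; adj u b; adj n b])
    (map (adj b) s) (map (adj a) s) (map (adj u) s) (map (adj n) s).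
Proof.
move=> s_uniq; have: all (fun c => uniq [:: c; b; a; u; n]) s.
  apply/allP => c cs; rewrite -rev_uniq; apply: subseq_uniq s_uniq.
  by rewrite /rev /= !eqxx sub1seq.
elim: s {s_uniq} => //= c s IH /andP[c_uniq /IH okc].
by have /= -> := lookup_free c_uniq.
Qed.

Lemma no_bad2_mat (n u a : G) s : uniq [:: n, u, a & s] ->
  no_bad2 (foldl child bad_tree [:: adj n u; adj u a; adj n a]) (mat s)
    (map (adj a) s) (map (adj u) s) (map (adj n) s).
Proof.
elim: s => // b s IH s_uniq.
have sIH : uniq [:: n, u, a & s].
  exact: subseq_uniq (cat_subseq (subseq_refl [:: n; u; a]) (subseq_cons s b)) s_uniq.
rewrite [mat _]/=; have := no_bad1_mat s_uniq; have := IH sIH.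
rewrite /= => ->; by case: (child _ _) => [[]|l r] // ->.
Qed.

Lemma no_bad3_mat (n u : G) s : uniq [:: n, u & s] ->
  no_bad3 (child bad_tree (adj n u)) (mat s) (map (adj u) s) (map (adj n) s).
Proof.
elim: s => // a s IH s_uniq.
have sIH : uniq [:: n, u & s].
  exact: subseq_uniq (cat_subseq (subseq_refl [:: n; u]) (subseq_cons s a)) s_uniq.
by rewrite [mat _]/=; have /= -> := no_bad2_mat s_uniq; apply: IH.
Qed.

Fixpoint fits (kn : seq (option bool)) (r : bitseq) : bool :=
  match kn, r with
  | o :: kn', b :: r' => agrees o b && fits kn' r'
  | _, _ => true
  end.

Lemma mem_grow_rows o ru st rs r b : r \in rs -> agrees o b ->
  no_bad3 (child bad_tree b) st ru r -> b :: r \in grow_rows o ru st rs.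
Proof.
move=> r_rs ob okb; apply/flatten_mapP; exists r => //.
by rewrite map_f // mem_filter ob okb; case: (b).
Qed.

(** Rows are discarded only for violating [kn] or creating a forbidden subgraph, so the true row of
    [u] survives. *)
Lemma mem_rows s (u : G) kn : uniq (u :: s) -> fits kn (map (adj u) s) ->
  map (adj u) s \in rows (mat s) kn.
Proof.
elim: s kn => // v s IH kn s_uniq s_fits.
have sIH : uniq (u :: s).
  exact: subseq_uniq (cat_subseq (subseq_refl [:: u]) (subseq_cons s v)) s_uniq.
apply: mem_grow_rows; last exact: no_bad3_mat.
  by apply: IH => //; case: kn s_fits => [|o kn] //= /andP[].
by case: kn s_fits => [|o kn] //= /andP[].
Qed.

Lemma fits_pad s (u : G) kn : size kn <= size s -> fits kn (map (adj u) s) ->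
  fits (pad (mat (s ++ bs)) (vtype u) kn) (map (adj u) (s ++ bs)).
Proof.
move=> kn_le kn_fits; rewrite /pad size_mat size_cat addnK map_cat -/(vtype u).
have fits_self r : fits [seq Some b | b <- r] r by elim: r => //= b r ->; rewrite eqxx.
move: (vtype u) => t; elim: s kn kn_le kn_fits => [|v s IH] [|o kn] //=.
  by move=> _ _; have := IH [::] isT isT; rewrite subn0.
by rewrite ltnS => kn_le /andP[-> /(IH _ kn_le)]; rewrite subSS.
Qed.

Lemma extend_sound kn k s u :
  extend (vtype u) kn k (mat (s ++ bs)) -> uniq (u :: s ++ bs) ->
  size kn <= size s -> fits kn (map (adj u) s) -> k (mat (u :: s ++ bs)).
Proof.
by move=> /allP ok s_uniq kn_le kn_fits; apply: ok; apply/mem_rows/fits_pad.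
Qed.

Lemma extend_some_sound ts k s u :
  extend_some ts k (mat (s ++ bs)) -> uniq (s ++ bs) -> vtype u \in ts ->
  exists2 s', uniq ((s' ++ s) ++ bs) & k (mat ((s' ++ s) ++ bs)).
Proof.
rewrite /extend_some; case: ifPn => [_ ok s_uniq _|no /allP ok s_uniq u_ts].
  by exists [::].
have u_notin : u \notin s ++ bs.
  apply: contra no => u_s; apply/hasP; exists (vtype u) => //.
  by rewrite unzip1_mat map_f.
exists [:: u]; first by rewrite /= u_notin.
by apply: (@extend_sound [::]); rewrite ?ok //= u_notin.
Qed.

(** The true row of each added vertex is enumerated; once the fuel is spent there are no rows, hence
    no further vertex. *)
Lemma extend_all_sound f t k s (us : seq G) :
  extend_all f t k (mat (s ++ bs)) -> uniq ((us ++ s) ++ bs) ->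
  all (fun u => vtype u == t) us -> k (mat ((us ++ s) ++ bs)).
Proof.
elim: f s us => [|f IH] s us /=; case: ifP => // ks.
(* Lists are newest first, so the last entry of [us] is added first. *)
all: case/lastP: us => [//|us u].
all: rewrite cat_rcons all_rcons => ok us_uniq /andP[/eqP u_t us_t].
all: have u_uniq : uniq (u :: s ++ bs)
  by move: us_uniq; rewrite -catA cat_uniq => /and3P[].
all: have u_gen : map (adj u) (s ++ bs) \in rows (mat (s ++ bs)) (pad (mat (s ++ bs)) t [::])
  by rewrite -u_t; apply/mem_rows/fits_pad.
  by move: u_gen; rewrite (nilP ok).
apply: (IH (u :: s)) => //.
have -> : mat ((u :: s) ++ bs) = (t, map (adj u) (s ++ bs)) :: mat (s ++ bs).
  by rewrite -u_t.
exact: (allP ok).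
Qed.

Lemma extend_alls_sound f ts k s :
  extend_alls f ts k (mat (s ++ bs)) -> uniq (s ++ bs) ->
  exists s', [/\ uniq ((s' ++ s) ++ bs), k (mat ((s' ++ s) ++ bs)) &
    forall u, vtype u \in ts -> u \in (s' ++ s) ++ bs].
Proof.
elim: ts s => [|t ts IH] s /= ok s_uniq; first by exists [::].
(* All vertices of type [t] that are not yet listed. *)
pose us := [seq u <- enum G | (vtype u == t) && (u \notin s ++ bs)].
have us_uniq : uniq ((us ++ s) ++ bs).
  rewrite -catA cat_uniq s_uniq filter_uniq ?enum_uniq //= andbT.
  by apply/hasPn => u us_u; rewrite mem_filter us_u !andbF.
have us_t : all (fun u => vtype u == t) us.
  by apply/allP => u; rewrite mem_filter => /andP[/andP[]].
have [s' [s'_uniq ks' s'_ts]] := IH _ (extend_all_sound ok us_uniq us_t) us_uniq.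
exists (s' ++ us); rewrite -[(s' ++ us) ++ s]catA; split=> // u.
rewrite inE => /predU1P[u_t|/s'_ts//].
rewrite -!catA mem_cat; case: (boolP (u \in s ++ bs)) => [u_s|u_s].
  by rewrite [X in _ || X]mem_cat u_s !orbT.
by rewrite [X in _ || X]mem_cat mem_filter u_t eqxx u_s mem_enum orbT.
Qed.

Lemma has_nonedge_sound t s p q : p != q -> vtype p = t -> vtype q = t ->
  ~~ adj p q -> p \in s -> q \in s -> has_nonedge t (mat s).
Proof.
move=> pq p_t q_t npq; elim: s => // u s IH.
have headP w : w \in s -> vtype u = t -> vtype w = t -> ~~ adj u w ->
    has_nonedge t (mat (u :: s)).
  move=> w_s u_t w_t uw; rewrite [mat _]/= /= -/(vtype u) u_t eqxx unzip1_mat zip_map has_map.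
  by rewrite ifT //; apply/hasP; exists w; rewrite //= -/(vtype w) uw w_t eqxx.
rewrite !inE => /predU1P[p_u|p_s] /predU1P[q_u|q_s].
- by rewrite p_u q_u eqxx in pq.
- by apply: (headP q); rewrite // -p_u.
- by apply: (headP p); rewrite // -q_u // adj_sym.
by rewrite /=; case: ifP => // _; apply: IH.
Qed.

Lemma extend_nonedge_sound t k s p q :
  extend_nonedge t k (mat (s ++ bs)) -> uniq (s ++ bs) -> t \notin map vtype bs ->
  p != q -> vtype p = t -> vtype q = t -> ~~ adj p q ->
  exists2 s', uniq ((s' ++ s) ++ bs) & k (mat ((s' ++ s) ++ bs)).
Proof.
move=> + s_uniq t_bs pq p_t q_t npq; rewrite /extend_nonedge; case: ifPn => [_ ok|none].
  by exists [::].
move=> /andP[/allP one_new two_new].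
(* No nonadjacent pair of type [t] is listed, so [p] or [q] is new. *)
wlog q_s : p q p_t q_t pq npq / q \notin s ++ bs.
  move=> wl; have [q_s|] := boolP (q \in s ++ bs); last exact: wl pq npq.
  apply: (wl q p); rewrite // 1?eq_sym 1?adj_sym //.
  by apply: contra none => p_s; apply: has_nonedge_sound npq p_s q_s.
have q_uniq : uniq (q :: s ++ bs) by rewrite /= q_s.
(* A listed [p] is one of the positions [i] tried by [one_new]; otherwise [two_new] adds [p], then
   [q]. *)
have [p_s|p_s] := boolP (p \in s ++ bs).
  exists [:: q] => //.
  have {}p_s : p \in s.
    move: p_s; rewrite mem_cat => /orP[//|/(map_f vtype)].
    by rewrite p_t (negPf t_bs).
  have i_lt : index p s < size s by rewrite index_mem.
  have := one_new (index p s).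
  rewrite mem_iota add0n size_mat size_cat (ltn_addr _ i_lt) => /(_ isT).
  rewrite unzip1_mat map_cat nth_cat size_map index_mem p_s (nth_map p) ?index_mem //.
  rewrite nth_index // p_t eqxx -q_t => /extend_sound; apply=> //.
    by rewrite size_rcons size_nseq index_mem.
  move: npq p_s; rewrite adj_sym; elim: (s) => //= v s' IH npq.
  rewrite inE eq_sym; case: eqVneq npq => [-> /negPf-> //|_ npq /= p_s'].
  exact: IH.
have p_uniq : uniq (p :: s ++ bs) by rewrite /= p_s.
have qp_uniq : uniq [:: q, p & s ++ bs] by rewrite /= inE negb_or eq_sym pq q_s p_s.
exists [:: q; p] => //.
move: two_new; rewrite -{1}p_t => /extend_sound/(_ p_uniq isT isT).
rewrite -q_t => /(@extend_sound _ _ (p :: s)); apply=> //=.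
by rewrite adj_sym (negPf npq).
Qed.

Fixpoint coloured (cols : seq nat) (sl : bitseq -> bool) (s : seq G)
    (cs : seq (option nat)) : Prop :=
  match s, cs with
  | u :: s', o :: cs' => coloured cols sl s' cs' /\
      (sl (vtype u) -> exists2 c, o = Some c /\ c \in cols & ~~ conflict c (map (adj u) s') cs')
  | [::], [::] => True
  | _, _ => False
  end.

Lemma colourings_sound cols sl s k : colourings cols sl (mat s) k ->
  exists2 cs, coloured cols sl s cs & k cs.
Proof.
elim: s k => [|u s IH] k /=; first by exists [::].
case/IH => cs s_cs; case: ifP => [u_sl|_ kcs]; last by exists (None :: cs) => //; split=> // /idP; rewrite ?u_sl.
have some_colourP (l : seq nat) f : some_colour l f -> exists2 c, c \in l & f c.
  elim: l => //= c l IHc; case: ifP => [fc _|_ /IHc[d dc fd]].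
    by exists c; rewrite ?inE ?eqxx.
  by exists d; rewrite // inE dc orbT.
case/some_colourP => c c_in; case: ifP => // nc kc; exists (Some c :: cs) => //.
by split=> // _; exists c => //; rewrite nc.
Qed.

Lemma colourable4_sound sl s : uniq s -> colourable4 sl (mat s) ->
  exists f : G -> nat, {in s &, forall u v, sl (vtype u) -> sl (vtype v) ->
    f u < 4 /\ (adj u v -> f u != f v)}.
Proof.
move=> s_uniq /colourings_sound[cs s_cs _].
(* Vertices left without a colour get the default 0; properness is claimed for selected types
   only. *)
exists (fun u => odflt 0 (nth None cs (index u s))).
elim: s cs s_uniq s_cs => [|w s IH] [|o cs] //= /andP[ws s_uniq] [s_cs w_cs].
have {}IH := IH _ s_uniq s_cs.
have conflictP c u (s' : seq G) cs' : u \in s' -> adj w u ->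
    nth None cs' (index u s') = Some c -> conflict c (map (adj w) s') cs'.
  elim: s' cs' => [|v s' IHs] [|o' cs'] //=; first by rewrite nth_nil.
  rewrite inE => /predU1P[<- wu|u_s wu].
    by rewrite eqxx wu /= => ->; rewrite eqxx.
  case: eqVneq => [-> /= ->|_ /= u_c]; first by rewrite wu eqxx.
  by have := IHs _ u_s wu u_c; case: (adj w v) => //; case: o' => // d ->; case: ifP.
have old u : u \in s -> (w == u) = false.
  by move=> u_s; apply: contraNF ws => /eqP->.
have inP u : u \in s -> sl (vtype u) -> nth None cs (index u s) != None.
  move=> u_s u_sl; move: s_cs u_s {IH ws s_uniq w_cs conflictP old}.
  elim: s cs => [|v s' IHs] [|o' cs'] //= [s_cs v_cs]; rewrite inE eq_sym.
  case: eqVneq => [uv _ /=|_ /=]; last exact: IHs.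
  by case: v_cs => [|c [-> _] _] //; rewrite uv.
move=> u v; rewrite !inE => /predU1P[->|u_s] /predU1P[->|v_s] u_sl v_sl.
- rewrite eqxx adj_irr; case: (w_cs u_sl) => c [-> c_in] _; split=> //=.
  by move: c_in; rewrite !inE => /or4P[] /eqP->.
- rewrite eqxx old //=; case: (w_cs u_sl) => c [-> c_in] nc; split.
    by move: c_in; rewrite !inE => /or4P[] /eqP->.
  move=> wv /=; have := inP _ v_s v_sl; case vc: (nth _ _ _) => [d|] //= _.
  by apply: contra nc => /eqP cd; apply: (conflictP c v) => //; rewrite vc cd.
- rewrite eqxx old //=; split; first by case: (IH u u u_s u_s u_sl u_sl).
  rewrite adj_sym => wu; case: (w_cs v_sl) => c [-> c_in] nc /=.
  have := inP _ u_s u_sl; case uc: (nth _ _ _) => [d|] //= _.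
  by apply: contra nc => /eqP cd; apply: (conflictP c u) => //; rewrite uc cd.
by rewrite !old //; apply: IH.
Qed.

End Soundness.

(** * Cliques and colourings *)

Section Invariants.
Variable G : sgraph.

Definition colours (S : {set G}) (k : nat) : Prop :=
  exists f : G -> nat, {in S, forall u, f u < k} /\
    {in S &, forall u v, adj u v -> f u != f v}.

Lemma coloursS (S T : {set G}) k : S \subset T -> colours T k -> colours S k.
Proof.
move=> /subsetP ST [f [f_lt f_adj]]; exists f; split=> [u /ST/f_lt//|u v /ST uT /ST vT].
exact: f_adj.
Qed.

Lemma coloursU (S T : {set G}) a b :
  colours S a -> colours T b -> colours (S :|: T) (a + b).
Proof.
move=> [f [f_lt f_adj]] [g [g_lt g_adj]].
exists (fun u => if u \in S then f u else a + g u); split=> [u|u v].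
  rewrite inE; case: ifP => [/f_lt uS _|_ /= /g_lt]; first exact: ltn_addr.
  by rewrite ltn_add2l.
rewrite !inE; case: ifP => [uS _|_ /= uT]; case: ifP => [vS _|_ /= vT] uv.
- exact: f_adj.
- by rewrite neq_ltn ltn_addr ?f_lt.
- by rewrite neq_ltn [f v < _]ltn_addr ?f_lt ?orbT.
by rewrite eqn_add2l g_adj.
Qed.

Lemma colours_stable (S : {set G}) : stable S -> colours S 1.
Proof.
move=> /forall_inP Sst; exists (fun=> 0); split=> // u v uS vS.
by rewrite (negPf (forall_inP (Sst u uS) v vS)).
Qed.

Lemma chi_le k : colours setT k -> chi G <= k.
Proof.
move=> [f [f_lt f_adj]]; rewrite /chi; case: ex_minnP => m _; apply.
apply/existsP; exists [ffun u => Ordinal (f_lt u (in_setT u))].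
apply/forallP => u; apply/forallP => v; apply/implyP => uv.
by rewrite !ffunE -val_eqE /= f_adj.
Qed.

Lemma cliqueP (A : {set G}) :
  reflect {in A &, forall u v, u != v -> adj u v} (clique A).
Proof.
apply: (iffP forall_inP) => [A_cl u v uA vA uv|A_cl u uA].
  exact: (implyP (forall_inP (A_cl u uA) v vA)).
by apply/forall_inP => v vA; apply/implyP; apply: A_cl.
Qed.

Lemma not_clique (A : {set G}) : ~~ clique A ->
  exists a b, [/\ a \in A, b \in A, a != b & ~~ adj a b].
Proof.
rewrite negb_forall_in => /exists_inP[a aA].
rewrite negb_forall_in => /exists_inP[b bA]; rewrite negb_imply => /andP[ab nab].
by exists a, b.
Qed.

Lemma clique_omega (A : {set G}) : clique A -> #|A| <= omega G.
Proof. exact: (@leq_bigmax_cond _ _ (fun A : {set G} => #|A|)). Qed.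

Lemma cliqueU1 (A : {set G}) u :
  clique A -> {in A, forall v, u != v -> adj u v} -> clique (u |: A).
Proof.
move=> /cliqueP A_cl uA; apply/cliqueP => v w /setU1P[->|vA] /setU1P[->|wA] vw.
- by rewrite eqxx in vw.
- exact: uA.
- by rewrite adj_sym uA // eq_sym.
exact: A_cl.
Qed.

Definition at_most_one_nonneighbour (S : {set G}) : Prop :=
  {in S & &, forall u v w, v != u -> w != u -> ~~ adj u v -> ~~ adj u w -> v = w}.

(* A maximal clique [K] of [S] meets every nonadjacent pair of [S], so its
   vertices can serve as colours. *)
Lemma colours_comatching (S : {set G}) : at_most_one_nonneighbour S ->
  exists2 K : {set G}, K \subset S & clique K /\ colours S #|K|.
Proof.
move=> S1.
have [K /maxsetP[/andP[KS K_cl] K_max]] :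
    {K | maxset (fun K : {set G} => (K \subset S) && clique K) K}.
  by apply: ex_maxset; exists set0; rewrite sub0set; apply/cliqueP => u; rewrite inE.
exists K => //; split=> //.
have KP u : exists k, (u \in S) ==> (k \in K) && ((u == k) || ~~ adj u k && (u != k)).
  have [uS|_] := boolP (u \in S); last by exists u.
  have [uK|uK] := boolP (u \in K); first by exists u; rewrite uK eqxx.
  suff [k /andP[kK uk]] : exists k, (k \in K) && ~~ adj u k.
    exists k; rewrite kK uk /= orbC; apply/orP; left.
    by apply: contraNneq uK => ->.
  apply/existsP; apply: contraR uK; rewrite negb_exists => /forallP uK.
  have <- : u |: K = K.
    apply: K_max; last exact: subsetU1.
    rewrite subUset sub1set uS KS; apply: cliqueU1 => // k kK _.
    by have := uK k; rewrite kK negbK.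
  exact: setU11.
pose g u := xchoose (KP u).
have gP u : u \in S -> (g u \in K) && ((u == g u) || ~~ adj u (g u) && (u != g u)).
  exact: implyP (xchooseP (KP u)).
exists (fun u => index (g u) (enum K)); split=> [u /gP/andP[gK _]|u v uS vS uv].
  by rewrite cardE index_mem mem_enum.
apply/negP => /eqP/(congr1 (nth u (enum K))).
have /andP[guK gu] := gP u uS; have /andP[gvK gv] := gP v vS.
rewrite !nth_index ?mem_enum // => guv.
have u_v : u != v by apply: contraTneq uv => ->; rewrite adj_irr.
(* Vertices sharing a colour in [K] are both equal to it, or one is its nonneighbour, or both are
   and so coincide. *)
case/predU1P: gu => [ug|/andP[ug u_g]]; case/predU1P: gv => [vg|/andP[vg v_g]].
- by rewrite ug vg guv eqxx in u_v.
- by rewrite -guv -ug adj_sym uv in vg.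
- by rewrite guv -vg uv in ug.
have gS : g u \in S by rewrite (subsetP KS).
have uE : u = v; last by rewrite uE eqxx in u_v.
apply: (S1 (g u)) => //; rewrite ?(adj_sym (g u)) // guv //.
Qed.

(** Seen in the complement: edges without a common vertex include two disjoint edges or a
    triangle. *)
Lemma almost_clique_or (x : G) (N : {set G}) :
  [\/ exists u, clique (N :\ u),
      exists u1 u2 u3 u4, [/\ [&& u1 \in N, u2 \in N, u3 \in N & u4 \in N],
        uniq [:: u1; u2; u3; u4], ~~ adj u1 u2 & ~~ adj u3 u4]
    | exists u1 u2 u3, [/\ [&& u1 \in N, u2 \in N & u3 \in N],
        uniq [:: u1; u2; u3] & [/\ ~~ adj u1 u2, ~~ adj u1 u3 & ~~ adj u2 u3]]].
Proof.
have [/existsP|/existsPn no1] := boolP [exists u, clique (N :\ u)]; first by constructor 1.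
have nonP u : exists a b, [/\ a \in N :\ u, b \in N :\ u, a != b & ~~ adj a b].
  exact: not_clique (no1 u).
have [a [b [/setD1P[_ aN] /setD1P[_ bN] ab nab]]] := nonP x.
have [[c [/setD1P[ca cN] cb nbc]]|[c [d [/andP[cN dN] abcd ncd]]]] :
    (exists c, [/\ c \in N :\ a, c != b & ~~ adj b c]) \/
    (exists c d, [/\ (c \in N) && (d \in N), uniq [:: a; b; c; d] & ~~ adj c d]).
- have [c [d [ca dN cd ncd]]] := nonP a; move: (ca) (dN) => /setD1P[ca' cN] /setD1P[da dN'].
  have [cb|cb] := eqVneq c b; first by left; exists d; rewrite dN eq_sym -cb cd ncd.
  have [db|db] := eqVneq d b; first by left; exists c; rewrite ca cb adj_sym -db ncd.
  right; exists c, d; rewrite cN dN' ncd /= !inE !negb_or ab (eq_sym a c) ca'.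
  by rewrite (eq_sym a d) da (eq_sym b c) cb (eq_sym b d) db cd.
(* A nonadjacent pair avoiding [b] either misses [c], hence is disjoint from [b], [c], or joins [c]
   to [a], giving a stable triple, or joins [c] to a vertex outside [a], [b]. *)
- have [e [f [/setD1P[eb eN] /setD1P[fb fN] ef nef]]] := nonP b.
  have [ce|ce] := eqVneq c e; last have [cf|cf] := eqVneq c f; last first.
  + constructor 2; exists b, c, e, f; rewrite bN cN eN fN nbc nef /= !inE !negb_or.
    by rewrite (eq_sym b c) (eq_sym b e) (eq_sym b f) cb eb fb ce cf ef.
  + have [ea|ea] := eqVneq e a.
      constructor 3; exists a, b, c; rewrite aN bN cN nab nbc /= !inE !negb_or ab.
      by rewrite (eq_sym a c) (eq_sym b c) ca cb -ea cf.
    constructor 2; exists a, b, c, e; rewrite aN bN cN eN nab adj_sym cf nef /= !inE !negb_or.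
    by rewrite -cf ab (eq_sym a) ca (eq_sym a) ea (eq_sym b) cb (eq_sym b) eb ce.
  + have [fa|fa] := eqVneq f a.
      constructor 3; exists a, b, c; rewrite aN bN cN nab nbc /= !inE !negb_or ab.
      by rewrite (eq_sym a c) (eq_sym b c) ca cb -fa adj_sym ce.
    constructor 2; exists a, b, c, f; rewrite aN bN cN fN nab ce nef /= !inE !negb_or.
    by rewrite -ce ab (eq_sym a) ca (eq_sym a) fa (eq_sym b) cb (eq_sym b) fb ce ef.
by constructor 2; exists a, b, c, d; rewrite aN bN cN dN.
Qed.
End Invariants.

(** * The bounded configurations *)

Definition chain (cs : seq (bitseq * seq (option bool))) (k : state -> bool) :=
  foldr (fun c => extend c.1 c.2) k cs.

(** With a constantly false continuation, success means that the enumeration has no leaf. *)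
Definition refuted (cs : seq (bitseq * seq (option bool))) : bool :=
  chain cs (fun=> false) base.

Definition outer_types := [:: tZ; tA1; tA2; tA3; tA4; tB1; tB2; tB3; tB4; tD].

(** With the cycle, a further vertex having exactly two, opposite, neighbours on it gives $K_{2,3}$,
    and one having three gives $\overline{P_2+P_3}$. *)
Lemma inner_types_refuted :
  all (fun t => (t \in outer_types) || refuted [:: (t, [::])])
    [seq [:: b.1.1; b.1.2; b.2.1; b.2.2] |
      b <- [seq (c, d) | c <- [seq (x, y) | x <- [:: true; false], y <- [:: true; false]],
                         d <- [seq (x, y) | x <- [:: true; false], y <- [:: true; false]]]].
Proof. by vm_compute. Qed.

(** An edge inside $Z+A_1$ and the path [v2], [v3], [v4] induce $P_2+P_3$. *)
Lemma pendants_refuted :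
  all (fun t => all (fun t' => refuted [:: (t, [::]); (t', [:: Some true])]) [:: tZ; tA1]) [:: tZ; tA1].
Proof. by vm_compute. Qed.

(** With [v1] and [v3], the three vertices of $D$ induce $K_{2,3}$ or $\overline{P_2+P_3}$, as the
    last two are nonadjacent or adjacent. *)
Lemma two_nonneighbours_refuted :
  refuted [:: (tD, [::]); (tD, [:: Some false]); (tD, [:: None; Some false])].
Proof. by vm_compute. Qed.

(** The pendant vertex and [v2] (or [v4]) are nonadjacent and share [v1] and both added vertices as
    neighbours; as [v1] sees neither of these, $K_{2,3}$ or $\overline{P_2+P_3}$ arises. *)
Lemma two_neighbours_refuted :
  all (fun ts => all (fun t => all (fun t' =>
    refuted [:: (tA1, [::]); (t, [:: Some true]); (t', [:: None; Some true])]) ts) ts)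
   [:: [:: tA2; tB2]; [:: tA4; tB3]].
Proof. by vm_compute. Qed.

(** This makes $B_1+B_3$ and $B_2+B_4$ colour classes when the pendants at [v1] and [v3] are
    nonadjacent. *)
Lemma opposite_refuted :
  all (fun ts => all (fun t => refuted [:: (tA1, [::]); (tA3, [:: Some false]);
                                           (t.1, [::]); (t.2, [:: Some true])])
    [seq (t, t') | t <- ts, t' <- ts]) [:: [:: tB1; tB3]; [:: tB2; tB4]].
Proof. by vm_compute. Qed.

(* The pendant vertex with two disjoint nonadjacent pairs, respectively a stable
   triple, of neighbours; a row lists the most recent vertex first. *)
Definition pair_chain t1 t2 t3 t4 :=
  [:: (tA1, [::]); (t1, [:: Some true]); (t2, [:: Some false; Some true]);
      (t3, [:: None; None; Some true]); (t4, [:: Some false; None; None; Some true])].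

Definition triple_chain t1 t2 t3 :=
  [:: (tA1, [::]); (t1, [:: Some true]); (t2, [:: Some false; Some true]);
      (t3, [:: Some false; Some false; Some true])].

(** These types see [v1], so a clique of such neighbours of the pendant [x] grows by [x] and
    [v1]. *)
Definition tN := [:: tB1; tB4; tD].

Definition non_nice_ctx (k : state -> bool) : bool :=
  all (fun t1 => all (fun t2 => all (fun t3 => chain (triple_chain t1 t2 t3) k base &&
    all (fun t4 => chain (pair_chain t1 t2 t3 t4) k base) tN) tN) tN) tN.

Lemma three_far_refuted :
  non_nice_ctx (fun st => all (fun t1 => all (fun t2 => all (fun t3 =>
    chain [:: (t1, [::]); (t2, [::]); (t3, [::])] (fun=> false) st)
    [:: tB2; tB3]) [:: tB2; tB3]) [:: tB2; tB3]).
Proof. by vm_compute. Qed.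

Lemma non_nice_colourable :
  non_nice_ctx (extend_nonedge tD (extend_some [:: tB2; tB3]
    (extend_some [:: tA4; tB3; tB4] (extend_some [:: tA2; tB1; tB2]
    (extend_alls 5 [:: tB2; tB3; tB4; tB1; tA4; tA2] (colourable4 residual)))))).
Proof. by vm_compute. Qed.

Definition tB := [:: tB1; tB2; tB3; tB4].
Definition at_most2 (ts : seq bitseq) (st : state) : bool :=
  count (fun t => t \in ts) (unzip1 st) <= 2.

(** The alternative to a colouring bounds by two the neighbours of [v1] or [v3] outside the cycle
    and $D$. *)
Lemma adjacent_pendants_colourable :
  chain [:: (tA1, [::]); (tA3, [:: Some true])] (extend_some tB
   (extend_alls 5 (tB ++ [:: tA1; tA3; tA2; tA4])
    (fun st => if colourable4 residual st then true else
       at_most2 [:: tA1; tB1; tB4] st || at_most2 [:: tA3; tB2; tB3] st))) base.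
Proof. by vm_compute. Qed.

Lemma adjacent_pendants_nonclique_colourable :
  chain [:: (tA1, [::]); (tA3, [:: Some true]); (tD, [::]); (tD, [:: Some false])]
   (extend_some tB (extend_alls 5 (tB ++ [:: tA1; tA3; tA2; tA4]) (colourable4 residual))) base.
Proof. by vm_compute. Qed.

Lemma nonadjacent_pendants_colourable :
  chain [:: (tA1, [::]); (tA3, [:: Some false])]
   (extend_some tB (extend_some [:: tA2] (extend_some [:: tA4]
    (extend_alls 5 (tB ++ [:: tA1; tA3; tA2; tA4]) (colourable4 residual))))) base.
Proof. by vm_compute. Qed.

(** An edge inside $A_i$ and the cycle without $v_i$ induce $P_2+P_3$. *)
Lemma stable_types_refuted :
  all (fun t => refuted [:: (t, [::]); (t, [:: Some true])]) [:: tA2; tA3; tA4].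
Proof. by vm_compute. Qed.

(** * Graphs with an induced 4-cycle *)

Section FourCycle.
Variables (G : sgraph) (G_free : bad5free G) (v1 v2 v3 v4 : G).
Hypothesis C4 : [&& adj v1 v2, adj v2 v3, adj v3 v4 & adj v4 v1].
Hypothesis C4_chordless : [&& v1 != v3, v2 != v4, ~~ adj v1 v3 & ~~ adj v2 v4].
Let bs := [:: v1; v2; v3; v4].
Local Notation vt := (vtype v1 v2 v3 v4).
Local Notation mt := (mat v1 v2 v3 v4).

Lemma vtype_base : (vt v1 = tO) * (vt v2 = tE) * (vt v3 = tO) * (vt v4 = tE).
Proof.
case/and4P: C4 => a12 a23 a34 a41; case/and4P: C4_chordless => _ _ /negPf a13 /negPf a24.
rewrite /vtype /= !adj_irr a12 a23 a34 a41 a13 a24 (adj_sym v1 v4) (adj_sym v2 v1).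
by rewrite (adj_sym v3 v2) (adj_sym v3 v1) (adj_sym v4 v3) (adj_sym v4 v2) a12 a23 a34 a41 a13 a24.
Qed.

Lemma mat_base : mt bs = base.
Proof.
have := vtype_base; rewrite /bs /= => -[[[-> ->] ->] ->].
case/and4P: C4 => a12 a23 a34 a41; case/and4P: C4_chordless => _ _ /negPf a13 /negPf a24.
by rewrite a12 a23 a34 (adj_sym v1 v4) a41 a13 a24.
Qed.

Lemma uniq_base : uniq bs.
Proof.
have ne u v : adj u v -> u != v by apply: contraTneq => ->; rewrite adj_irr.
case/and4P: C4 => /ne n12 /ne n23 /ne n34; rewrite adj_sym => /ne n14.
by case/and4P: C4_chordless => n13 n24 _ _; rewrite /= !inE !negb_or n12 n13 n14 n23 n24 n34.
Qed.

Lemma outer_notin_base u : vt u \notin [:: tE; tO] -> u \notin bs.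
Proof.
by apply: contra; rewrite !inE => /or4P[] /eqP->; rewrite vtype_base.
Qed.

Lemma uniq_outer s : uniq s -> all (fun u => vt u \notin [:: tE; tO]) s -> uniq (s ++ bs).
Proof.
move=> s_uniq /allP s_out; rewrite cat_uniq s_uniq uniq_base andbT andTb.
by apply/hasPn => u u_bs; apply: contraL u_bs => /s_out/outer_notin_base.
Qed.

(** [us] is in order of insertion but [s] is newest first, whence [catrev] below. *)
Fixpoint fits_chain (cs : seq (bitseq * seq (option bool))) (us s : seq G) : bool :=
  match cs, us with
  | c :: cs', u :: us' =>
    [&& vt u == c.1, size c.2 <= size s, fits c.2 (map (adj u) s) & fits_chain cs' us' (u :: s)]
  | [::], [::] => true
  | _, _ => false
  end.

Lemma chain_sound cs k us s :
  chain cs k (mt (s ++ bs)) -> fits_chain cs us s -> uniq (catrev us s ++ bs) ->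
  k (mt (catrev us s ++ bs)).
Proof.
elim: cs us s => [|[t kn] cs IH] [|u us] s //= ok /and4P[/eqP u_t kn_le kn_fits us_fits] us_uniq.
apply: (IH us (u :: s)) => //; apply: (extend_sound G_free) kn_le kn_fits; rewrite ?u_t //.
by move: us_uniq; rewrite catrevE -catA cat_uniq => /and3P[].
Qed.

Lemma fits_chain_outer cs us s : all (fun c => c.1 \notin [:: tE; tO]) cs ->
  fits_chain cs us s -> all (fun u => vt u \notin [:: tE; tO]) us.
Proof.
elim: cs us s => [|c cs IH] [|u us] s //= /andP[c_out cs_out] /and4P[/eqP-> _ _ us_fits].
by rewrite c_out (IH us (u :: s)).
Qed.

Lemma chain0_sound cs k us : chain cs k base -> fits_chain cs us [::] ->
  all (fun c => c.1 \notin [:: tE; tO]) cs -> uniq us ->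
  uniq (rev us ++ bs) /\ k (mt (rev us ++ bs)).
Proof.
move=> ok us_fits cs_out us_uniq.
have us_bs : uniq (rev us ++ bs).
  rewrite uniq_outer ?rev_uniq // all_rev; exact: fits_chain_outer us_fits.
by split=> //; apply: (@chain_sound cs k us [::]) => //; rewrite cat0s mat_base.
Qed.

Lemma refuted_sound cs us : refuted cs -> fits_chain cs us [::] ->
  all (fun c => c.1 \notin [:: tE; tO]) cs -> uniq us -> False.
Proof. by move=> ok us_fits cs_out us_uniq; case: (chain0_sound ok us_fits cs_out us_uniq). Qed.

(** Cycle vertices have refuted types too, hence membership instead of a contradiction. *)
Lemma refuted_in_base u : refuted [:: (vt u, [::])] -> u \in bs.
Proof.
move=> ref; apply/negPn/negP => u_bs.
have /= : (fun _ : state => false) (mt (catrev [:: u] [::] ++ bs)).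
  apply: (@chain_sound [:: (vt u, [::])] (fun=> false) [:: u] [::]).
  - by rewrite cat0s mat_base.
  - by rewrite /= eqxx.
  by rewrite /catrev cat_cons cat0s cons_uniq u_bs uniq_base.
by [].
Qed.

Lemma vtype_cases u : vt u \in [:: tE, tO & outer_types].
Proof.
have := allP inner_types_refuted (vt u); rewrite (_ : vt u \in _); last first.
  by rewrite /vtype /=; case: (adj u v1); case: (adj u v2); case: (adj u v3); case: (adj u v4).
case/(_ isT)/orP=> [u_out|/refuted_in_base].
  by rewrite in_cons in_cons u_out !orbT.
by rewrite !inE => /or4P[] /eqP->; rewrite vtype_base.
Qed.

Lemma vtype_tE u : vt u = tE -> u \in [:: v2; v4].
Proof.
move=> u_t; have := @refuted_in_base u; rewrite u_t => /(_ (allP inner_types_refuted tE isT)).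
by move: u_t; rewrite !inE => + /or4P[] /eqP uE; rewrite uE vtype_base // eqxx ?orbT.
Qed.

Lemma vtype_tO u : vt u = tO -> u \in [:: v1; v3].
Proof.
move=> u_t; have := @refuted_in_base u; rewrite u_t => /(_ (allP inner_types_refuted tO isT)).
by move: u_t; rewrite !inE => + /or4P[] /eqP uE; rewrite uE vtype_base // eqxx ?orbT.
Qed.

(** * Classes of vertices by type, with the colour and degree counts *)

Definition cls (ts : seq bitseq) : {set G} := [set u | vt u \in ts].

Lemma at_most_one_D : at_most_one_nonneighbour (cls [:: tD]).
Proof.
move=> d e f; rewrite !inE => /eqP d_t /eqP e_t /eqP f_t ed fd nde ndf.
apply/eqP/negPn/negP => ef.
apply: (refuted_sound (us := [:: d; e; f]) two_nonneighbours_refuted) => //.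
  by rewrite /= -!/(vtype v1 v2 v3 v4 _) d_t e_t f_t (adj_sym e d) (adj_sym f d) (negPf nde) (negPf ndf).
by rewrite /= !inE !negb_or (eq_sym d e) (eq_sym d f) ed fd ef.
Qed.

Lemma stable_pendants : stable (cls [:: tZ; tA1; tE]).
Proof.
apply/forall_inP => u u_S; apply/forall_inP => w w_S; apply/negP => uw.
have u_w : u != w by apply: contraTneq uw => ->; rewrite adj_irr.
have far t : t \in [:: tZ; tA1] -> ~~ nth false t 1 && ~~ nth false t 3.
  by rewrite !inE => /orP[] /eqP->.
have out y z : vt y \in [:: tZ; tA1] -> vt z = tE -> ~~ adj y z.
  move=> y_t z_t; have /andP[y2 y4] := far _ y_t.
  by have := vtype_tE z_t; rewrite !inE => /orP[] /eqP->.
case/and4P: C4_chordless => _ _ _ n24.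
have split_S y : y \in cls [:: tZ; tA1; tE] -> vt y \in [:: tZ; tA1] \/ vt y = tE.
  by rewrite !inE orbA => /orP[->|/eqP->]; [left|right].
case: (split_S u u_S) (split_S w w_S) => [u_t|u_t] [w_t|w_t].
- have := allP (allP pendants_refuted _ u_t) _ w_t => ref.
  apply: (refuted_sound (us := [:: u; w]) ref).
  + by rewrite /= -!/(vtype v1 v2 v3 v4 _) !eqxx adj_sym uw.
  + by move: u_t w_t; rewrite !inE => /orP[] /eqP-> /orP[] /eqP->.
  + by rewrite /= inE u_w.
- by rewrite (negPf (out _ _ u_t w_t)) in uw.
- by rewrite adj_sym (negPf (out _ _ w_t u_t)) in uw.
move: uw; have := vtype_tE u_t; have := vtype_tE w_t; rewrite !inE.
by case/orP=> /eqP-> /orP[] /eqP->; rewrite ?adj_irr ?(negPf n24) // adj_sym (negPf n24).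
Qed.

(** The adjacent vertices [v1] and [v2] see all of $D$ and enlarge [K]. *)
Lemma clique_D_omega (K : {set G}) : K \subset cls [:: tD] -> clique K -> #|K| + 2 <= omega G.
Proof.
move=> KD K_cl.
have D_adj u : u \in K -> adj v1 u /\ adj v2 u.
  move=> /(subsetP KD); rewrite !inE /vtype /= => /eqP[u1 u2 _ _].
  by rewrite (adj_sym v1) (adj_sym v2).
have v1K : v1 \notin K by apply/negP => /D_adj[]; rewrite adj_irr.
have v2K : v2 \notin K by apply/negP => /D_adj[]; rewrite adj_irr.
case/and4P: C4 => a12 _ _ _.
have v12 : v1 != v2 by apply: contraTneq a12 => ->; rewrite adj_irr.
have := @clique_omega _ (v1 |: (v2 |: K)); rewrite !cardsU1 !inE (negPf v12) v1K v2K addnA addnC.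
apply; apply: cliqueU1; first by apply: cliqueU1 => // u /D_adj[].
by move=> u /setU1P[->|/D_adj[]].
Qed.

Lemma good_of_colours : colours [set u | residual (vt u)] 4 -> good G.
Proof.
move=> R4; do 4 right.
have [K KD [K_cl D_K]] := colours_comatching at_most_one_D.
(* One colour for the stable set, at most $\omega-2$ for $D$ and four for the residual graph. *)
apply: leq_trans (_ : 1 + (#|K| + 4) <= _); last first.
  by rewrite addnCA (_ : 1 + 4 = 2 + 3) // addnA leq_add2r clique_D_omega.
apply: chi_le; apply: coloursS (coloursU (colours_stable stable_pendants) (coloursU D_K R4)).
apply/subsetP => u _; rewrite !inE /residual !inE.
by case: (vt u == tZ); case: (vt u == tA1); case: (vt u == tE); case: (vt u == tD).
Qed.

Lemma vtype_all (P : pred bitseq) u : all P [:: tE, tO & outer_types] -> P (vt u).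
Proof. by move/allP; apply; apply: vtype_cases. Qed.

Lemma colours_of_leaf s : uniq (s ++ bs) -> colourable4 residual (mt (s ++ bs)) ->
  (forall u, vt u \in tB ++ [:: tA2; tA3; tA4] -> u \in s ++ bs) ->
  colours [set u | residual (vt u)] 4.
Proof.
move=> s_uniq s_col s_all; have [f fP] := colourable4_sound s_uniq s_col.
have in_s u : residual (vt u) -> u \in s ++ bs.
  have := @vtype_all (fun t => residual t ==> (t \in tB ++ [:: tA2; tA3; tA4]) || (t == tO)) u isT.
  move=> /implyP uP /uP/orP[/s_all //|/eqP/vtype_tO u13]; rewrite mem_cat; apply/orP; right.
  by move: u13; rewrite !inE => /orP[] ->; rewrite ?orbT.
exists f; split=> [u|u v]; rewrite !inE => u_sel.
  by have [] := fP u u (in_s u u_sel) (in_s u u_sel) u_sel u_sel.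
by move=> v_sel; have [] := fP u v (in_s u u_sel) (in_s v v_sel) u_sel v_sel.
Qed.

Lemma adj_sym_vtype u : [/\ adj v1 u = nth false (vt u) 0, adj v2 u = nth false (vt u) 1,
  adj v3 u = nth false (vt u) 2 & adj v4 u = nth false (vt u) 3].
Proof. by rewrite /= !(adj_sym u). Qed.

Lemma deg_le v (ts : seq bitseq) :
  (forall u, adj v u -> vt u \in [:: tE, tD & ts]) -> deg v <= 2 + #|cls ts| + #|cls [:: tD]|.
Proof.
move=> v_ts; rewrite /deg.
have sub_v : nbhd v \subset [set v2; v4] :|: cls ts :|: cls [:: tD].
  apply/subsetP => u; rewrite inE => /v_ts; rewrite !inE.
  by case/or3P=> [/eqP/vtype_tE|->|->]; rewrite ?orbT // !inE => ->.
apply: leq_trans (subset_leq_card sub_v) _; apply: leq_trans (leq_card_setU _ _) _.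
rewrite leq_add2r; apply: leq_trans (leq_card_setU _ _) _; rewrite leq_add2r.
by rewrite cards2; case: (v2 != v4).
Qed.

(** The degree is at most 2 from [v2] and [v4], plus 2 from [ts], plus $\omega-2$ from the clique
    $D$. *)
Lemma nice_of_deg v (ts : seq bitseq) : clique (cls [:: tD]) ->
  (forall u, adj v u -> vt u \in [:: tE, tD & ts]) -> #|cls ts| <= 2 -> good G.
Proof.
move=> D_cl v_ts ts2; right; right; left; exists v; rewrite /nice_vertex.
apply: leq_trans (deg_le v_ts) _; have := clique_D_omega (subxx _) D_cl.
rewrite addnC => D_omega; rewrite addnC; apply: leq_trans (_ : #|cls [:: tD]| + (2 + 2) <= _).
  by rewrite leq_add2l leq_add2l.
by rewrite addnA leq_add2r addnC.
Qed.

Lemma nbr_v1 u : adj v1 u -> vt u \in [:: tE; tD; tA1; tB1; tB4].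
Proof.
have [-> _ _ _] := adj_sym_vtype u; apply/implyP.
exact: (@vtype_all (fun t => nth false t 0 ==> (t \in [:: tE; tD; tA1; tB1; tB4]))).
Qed.

Lemma nbr_v3 u : adj v3 u -> vt u \in [:: tE; tD; tA3; tB2; tB3].
Proof.
have [_ _ -> _] := adj_sym_vtype u; apply/implyP.
exact: (@vtype_all (fun t => nth false t 2 ==> (t \in [:: tE; tD; tA3; tB2; tB3]))).
Qed.

Lemma stable_cls1 t : t \in [:: tA2; tA3; tA4] -> stable (cls [:: t]).
Proof.
move=> t_in; apply/forall_inP => u; rewrite !inE => /eqP u_t.
apply/forall_inP => w; rewrite !inE => /eqP w_t; apply/negP => uw.
have u_w : u != w by apply: contraTneq uw => ->; rewrite adj_irr.
apply: (refuted_sound (us := [:: u; w]) (allP stable_types_refuted _ t_in)).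
- by rewrite /= -!/(vtype v1 v2 v3 v4 _) u_t w_t !eqxx adj_sym uw.
- by move: t_in; rewrite !inE => /or3P[] /eqP->.
by rewrite /= inE u_w.
Qed.

Lemma stable_tO t : t \in [:: tA2; tA4] -> stable (cls [:: tO; t]).
Proof.
move=> t_in; have t_in3 : t \in [:: tA2; tA3; tA4].
  by move: t_in; rewrite !inE => /orP[] ->; rewrite ?orbT.
have t_O u w : vt u = tO -> vt w = t -> ~~ adj u w.
  move=> /vtype_tO u_13 w_t; have [w1 _ w3 _] := adj_sym_vtype w; rewrite w_t in w1 w3.
  by move: u_13 t_in; rewrite !inE => /orP[] /eqP->; rewrite ?w1 ?w3 => /orP[] /eqP->.
apply/forall_inP => u; rewrite !inE => /orP[] /eqP u_t; apply/forall_inP => w;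
  rewrite !inE => /orP[] /eqP w_t.
- move: u_t w_t => /vtype_tO + /vtype_tO; rewrite !inE; case/and4P: C4_chordless => _ _ n13 _.
  by move=> /orP[] /eqP-> /orP[] /eqP->; rewrite ?adj_irr // adj_sym.
- exact: t_O.
- by rewrite adj_sym t_O.
by apply: (forall_inP (forall_inP (stable_cls1 t_in3) u _)); rewrite !inE ?u_t ?w_t.
Qed.

Lemma set0_cls ts : cls ts = set0 -> forall u, vt u \notin ts.
Proof. by move=> /setP ts0 u; have := ts0 u; rewrite !inE => ->. Qed.

(** Three stable sets cover the residual graph: $\{v_1,v_3\}\cup A_2$, $A_3$ and $A_4$. *)
Lemma good_no_B : cls tB = set0 -> good G.
Proof.
move=> /set0_cls noB; apply: good_of_colours.
have := coloursU (colours_stable (@stable_tO tA2 isT))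
  (coloursU (colours_stable (@stable_cls1 tA3 isT)) (colours_stable (@stable_cls1 tA4 isT))).
move=> [f [f_lt f_adj]]; apply: (@coloursS _ _ (cls [:: tO; tA2] :|: (cls [:: tA3] :|: cls [:: tA4]))).
  apply/subsetP => u; rewrite !inE; have := noB u.
  have := @vtype_all (fun t => (t \notin tB) ==> residual t ==>
    [|| (t == tO) || (t == tA2), t == tA3 | t == tA4]) u isT.
  by move=> /implyP uP /uP /implyP.
by exists f; split=> // u /f_lt /ltnW.
Qed.

Lemma neq_vtype u w : vt u != vt w -> u != w.
Proof. by apply: contraNneq => ->. Qed.

Lemma not_clique_D : ~~ clique (cls [:: tD]) ->
  exists p q, [/\ p != q, vt p = tD, vt q = tD & ~~ adj p q].
Proof.
by case/not_clique=> p [q []]; rewrite !inE => /eqP p_t /eqP q_t pq npq; exists p, q.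
Qed.

Lemma tD_notin_base : tD \notin map vt bs.
Proof. by rewrite /bs; have := vtype_base; rewrite [map _ _]/= => -[[[-> ->] ->] ->]. Qed.

Lemma card_cls_le ts s : (forall u, vt u \in ts -> u \in s) -> at_most2 ts (mt s) -> #|cls ts| <= 2.
Proof.
move=> s_ts; rewrite /at_most2 unzip1_mat count_map -size_filter.
apply: leq_trans; apply: leq_trans (card_size _); apply: subset_leq_card.
by apply/subsetP => u; rewrite inE => u_ts; rewrite mem_filter /= u_ts s_ts.
Qed.

(** * The graph around a pendant vertex [x] at [v1] *)

Section Pendant.
Variables (x : G) (x_t : vt x = tA1).

Lemma good_opposite_pendants y : vt y = tA3 -> good G.
Proof.
move=> y_t; have xy : x != y by rewrite neq_vtype ?x_t ?y_t.
have [/eqP/good_no_B //|/set0Pn[b]] := boolP (cls tB == set0); rewrite inE => b_t.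
have fin ts : tB ++ [:: tA1; tA3; tA2; tA4] = ts ->
    forall s, uniq (s ++ bs) -> colourable4 residual (mt (s ++ bs)) ->
    (forall u, vt u \in ts -> u \in s ++ bs) -> good G.
  move=> <- s s_uniq s_col s_all; apply: good_of_colours.
  apply: colours_of_leaf s_uniq s_col _ => u u_t.
  by apply: s_all; move: u_t; rewrite !mem_cat => /orP[->//|]; rewrite !inE => /or3P[] ->; rewrite !orbT.
have [ayx|nyx] := boolP (adj y x).
  have [D_cl|/not_clique_D[p [q [pq p_t q_t npq]]]] := boolP (clique (cls [:: tD])).
    have [|//||s_uniq ok] := chain0_sound (us := [:: x; y]) adjacent_pendants_colourable.
    - by rewrite /= -!/(vtype v1 v2 v3 v4 _) x_t y_t ayx.
    - by rewrite /= inE xy.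
    have {ok s_uniq} [s1 s_uniq ok] := extend_some_sound G_free ok s_uniq b_t.
    have {ok s_uniq} [s2 [s_uniq ok s_all]] := extend_alls_sound G_free ok s_uniq.
    move: ok; case: ifP => [ok _|_]; first exact: (fin _ erefl _ s_uniq ok s_all).
    case/orP=> /card_cls_le card2.
      apply: (nice_of_deg D_cl nbr_v1); apply: card2 => u u_t; apply: s_all.
      by move: u_t; rewrite !inE => /or3P[] ->; rewrite ?orbT.
    apply: (nice_of_deg D_cl nbr_v3); apply: card2 => u u_t; apply: s_all.
    by move: u_t; rewrite !inE => /or3P[] ->; rewrite ?orbT.
  have [|//||s_uniq ok] := chain0_sound (us := [:: x; y; p; q])
    adjacent_pendants_nonclique_colourable.
  - by rewrite /= -!/(vtype v1 v2 v3 v4 _) x_t y_t p_t q_t ayx adj_sym (negPf npq).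
  - by rewrite /= !inE !negb_or pq !neq_vtype ?x_t ?y_t ?p_t ?q_t.
  have {ok s_uniq} [s1 s_uniq ok] := extend_some_sound G_free ok s_uniq b_t.
  have {ok s_uniq} [s2 [s_uniq ok s_all]] := extend_alls_sound G_free ok s_uniq.
  exact: (fin _ erefl _ s_uniq ok s_all).
have two_B ts : ts \in [:: [:: tB1; tB3]; [:: tB2; tB4]] -> stable (cls ts).
  move=> ts_in; apply/forall_inP => u; rewrite inE => u_t.
  apply/forall_inP => w; rewrite inE => w_t; apply/negP => uw.
  have u_w : u != w by apply: contraTneq uw => ->; rewrite adj_irr.
  have B_t t : t \in ts -> t \in tB.
    by move: ts_in; rewrite !inE => /orP[] /eqP->; rewrite !inE => /orP[] ->; rewrite ?orbT.
  have B_ne t : t \in tB -> [&& t != tA1, t != tA3 & t \notin [:: tE; tO]].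
    by rewrite !inE => /or4P[] /eqP->.
  have /and3P[u1 u3 uE] := B_ne _ (B_t _ u_t); have /and3P[w1 w3 wE] := B_ne _ (B_t _ w_t).
  apply: (refuted_sound (us := [:: x; y; u; w])
    (allP (allP opposite_refuted _ ts_in) _ (allpairs_f pair u_t w_t))).
  - by rewrite /= -!/(vtype v1 v2 v3 v4 _) x_t y_t !eqxx (negPf nyx) adj_sym uw.
  - by rewrite /= uE wE.
  by rewrite /= !inE !negb_or u_w !neq_vtype ?x_t ?y_t // eq_sym.
(* If $A_2$ or $A_4$ is empty, four stable sets suffice: [v1] and [v3] with the other of these two,
   $A_3$, $B_1+B_3$ and $B_2+B_4$. *)
have two_A t t' : t \in [:: tA2; tA4] -> (t' == tA2) || (t' == tA4) -> t != t' ->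
    (forall u, vt u != t') -> good G.
  move=> t_in t'_in tt' no_t'; apply: good_of_colours.
  apply: coloursS (coloursU (coloursU (colours_stable (stable_tO t_in)) (colours_stable (@stable_cls1 tA3 isT)))
    (coloursU (colours_stable (@two_B [:: tB1; tB3] isT)) (colours_stable (@two_B [:: tB2; tB4] isT)))).
  apply/subsetP => u; rewrite !inE; have := no_t' u.
  by move: t_in t'_in tt'; rewrite !inE => /orP[] /eqP-> /orP[] /eqP-> // _ u_t';
    apply/implyP; move: u_t'; apply/implyP; move: (vt u) (vtype_cases u); apply/allP.
have [/existsP[a /eqP a_t]|/existsPn noA2] := boolP [exists a, vt a == tA2]; last first.
  exact: (@two_A tA4 tA2).
have [/existsP[c /eqP c_t]|/existsPn noA4] := boolP [exists c, vt c == tA4]; last first.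
  exact: (@two_A tA2 tA4).
have [|//||s_uniq ok] := chain0_sound (us := [:: x; y]) nonadjacent_pendants_colourable.
- by rewrite /= -!/(vtype v1 v2 v3 v4 _) x_t y_t (negPf nyx).
- by rewrite /= inE xy.
have {ok s_uniq} [s1 s_uniq ok] := extend_some_sound G_free ok s_uniq b_t.
have {ok s_uniq} [|s2 s_uniq ok] := extend_some_sound (u := a) G_free ok s_uniq.
  by rewrite a_t.
have {ok s_uniq} [|s3 s_uniq ok] := extend_some_sound (u := c) G_free ok s_uniq.
  by rewrite c_t.
have {ok s_uniq} [s4 [s_uniq ok s_all]] := extend_alls_sound G_free ok s_uniq.
exact: (fin _ erefl _ s_uniq ok s_all).
Qed.

Hypothesis noA3 : forall u, vt u != tA3.

Lemma card_le1 (N : {set G}) ts : {subset N <= nbhd x} ->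
  ts \in [:: [:: tA2; tB2]; [:: tA4; tB3]] -> {in N, forall u, vt u \in ts} -> #|N| <= 1.
Proof.
move=> N_x ts_in N_ts; rewrite leqNgt; apply/negP => /card_gt1P[u [w [uN wN uw]]].
have [u_t w_t] := (N_ts u uN, N_ts w wN).
have [] := (N_x u uN, N_x w wN); rewrite !inE => xu xw.
have far t : t \in ts -> (t != tA1) && (t \notin [:: tE; tO]).
  by move: ts_in; rewrite !inE => /orP[] /eqP->; rewrite !inE => /orP[] /eqP->.
have [/andP[u1 uE] /andP[w1 wE]] := (far _ u_t, far _ w_t).
apply: (refuted_sound (us := [:: x; u; w])
  (allP (allP (allP two_neighbours_refuted _ ts_in) _ u_t) _ w_t)).
- by rewrite /= -!/(vtype v1 v2 v3 v4 _) x_t !eqxx (adj_sym u) (adj_sym w) xu xw.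
- by rewrite /= uE wE.
by rewrite /= !inE !negb_or uw !neq_vtype ?x_t // eq_sym.
Qed.

(** The 3 counts [v1], one vertex of $A_2+B_2$ and one of $A_4+B_3$; $Z+A_1$, [v2] and [v4] share a
    stable set with [x]. *)
Lemma nbhd_pendant : deg x <= 3 + #|nbhd x :&: cls tN|.
Proof.
set N := _ :&: _; pose N2 := nbhd x :&: cls [:: tA2; tB2]; pose N4 := nbhd x :&: cls [:: tA4; tB3].
have sub_x : nbhd x \subset [set v1] :|: N2 :|: N4 :|: N.
  apply/subsetP => u xu; have := xu; rewrite inE => x_u; rewrite !inE x_u.
  have := @vtype_all (fun t => [|| t \in [:: tZ; tA1; tE], t == tO, t == tA3, t \in [:: tA2; tB2],
    t \in [:: tA4; tB3] | t \in tN]) u isT.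
  case/or4P=> [u_t|/eqP/vtype_tO|u_t|/or3P[] u_t].
  - have x_S : x \in cls [:: tZ; tA1; tE] by rewrite !inE x_t.
    have u_S : u \in cls [:: tZ; tA1; tE] by rewrite inE.
    by have := forall_inP (forall_inP stable_pendants x x_S) u u_S; rewrite x_u.
  - rewrite !inE => /orP[] uE; first by rewrite uE.
    by move: x_t x_u; rewrite (eqP uE) => -[_ _ ->].
  - by rewrite (negPf (noA3 u)) in u_t.
  - by move: u_t; rewrite !inE => ->; rewrite ?orbT.
  - by move: u_t; rewrite !inE => ->; rewrite ?orbT.
  - by move: u_t; rewrite !inE => ->; rewrite ?orbT.
apply: leq_trans (subset_leq_card sub_x) _; apply: leq_trans (leq_card_setU _ _) _.
rewrite leq_add2r; apply: leq_trans (leq_card_setU _ _) _.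
have N4_1 : #|N4| <= 1.
  by apply: (@card_le1 _ [:: tA4; tB3]) => // u; rewrite inE => /andP[] // _; rewrite inE.
apply: (@leq_add _ _ 2 1) => //; apply: leq_trans (leq_card_setU _ _) _.
rewrite cards1; apply: (@leq_add _ _ 1 1) => //.
by apply: (@card_le1 _ [:: tA2; tB2]) => // u; rewrite inE => /andP[] // _; rewrite inE.
Qed.

Lemma non_nice_ctx_sound k : omega G + 2 < deg x -> non_nice_ctx k ->
  exists s, [/\ uniq (s ++ bs), all (fun u => vt u \in tA1 :: tN) s & k (mt (s ++ bs))].
Proof.
move=> x_deg ok; set N := nbhd x :&: cls tN.
have NP u : u \in N -> [/\ adj x u, vt u \in tN, x != u & vt u \notin [:: tE; tO]].
  rewrite !inE => /andP[xu u_t]; split=> //.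
    by apply: contraTneq xu => <-; rewrite adj_irr.
  by case/or3P: u_t => /eqP->.
have tNP u : vt u \in tN -> vt u \in tA1 :: tN by move=> u_t; rewrite in_cons u_t orbT.
case: (almost_clique_or x N) => [[u N_cl]|[u1 [u2 [u3 [u4]]]]|[u1 [u2 [u3]]]].
- have NP' w : w \in N :\ u -> [/\ adj x w, adj v1 w, x != w & v1 != w].
    case/setD1P=> _ /NP[xw w_t x_w w_out].
    have [-> _ _ _] := adj_sym_vtype w; split=> //; first by move: w_t; rewrite !inE => /or3P[] /eqP->.
    by rewrite neq_vtype // vtype_base; apply: contra w_out => /eqP<-.
  have xv1 : adj x v1 by move: x_t => -[].
  have x_v1 : x != v1 by apply: contraTneq xv1 => ->; rewrite adj_irr.
  (* So [N :\ u] has at most $\omega-2$ vertices and [x] degree at most $3+1+(\omega-2)$, against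
     [x_deg]. *)
  have : clique (x |: (v1 |: N :\ u)).
    apply: cliqueU1; first by apply: cliqueU1 => // w /NP'[].
    by move=> w /setU1P[->|/NP'[]].
  move/clique_omega; rewrite !cardsU1 in_setU1 (negPf x_v1).
  rewrite (_ : x \in N :\ u = false); last by apply/negP => /NP'[_ _]; rewrite eqxx.
  rewrite (_ : v1 \in N :\ u = false); last by apply/negP => /NP'[_ _ _]; rewrite eqxx.
  move=> N_omega; have := leq_trans x_deg nbhd_pendant; rewrite -/N (cardsD1 u N) => deg_N.
  have : 3 + ((u \in N) + #|N :\ u|) <= omega G + 2.
    apply: leq_trans (_ : 3 + (1 + #|N :\ u|) <= _); first by rewrite leq_add2l leq_add2r leq_b1.
    by rewrite addn2; exact: N_omega.
  by rewrite leqNgt deg_N.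
- case=> /and4P[/NP[xu1 t1 x1 o1] /NP[xu2 t2 x2 o2] /NP[xu3 t3 x3 o3] /NP[xu4 t4 x4 o4]] u_uniq n12 n34.
  have := allP (allP (allP ok _ t1) _ t2) _ t3 => /andP[_ /allP/(_ _ t4)] {}ok.
  have [|||us_uniq kus] := chain0_sound (us := [:: x; u1; u2; u3; u4]) ok.
  + rewrite /= -!/(vtype v1 v2 v3 v4 _) x_t !eqxx !(adj_sym _ x) xu1 xu2 xu3 xu4.
    by rewrite (adj_sym u2 u1) (adj_sym u4 u3) (negPf n12) (negPf n34).
  + by rewrite /= o1 o2 o3 o4.
  + by rewrite cons_uniq u_uniq !inE !negb_or x1 x2 x3 x4.
  exists (rev [:: x; u1; u2; u3; u4]); split=> //.
  by rewrite all_rev /all x_t !tNP.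
case=> /and3P[/NP[xu1 t1 x1 o1] /NP[xu2 t2 x2 o2] /NP[xu3 t3 x3 o3]] u_uniq [n12 n13 n23].
have := allP (allP (allP ok _ t1) _ t2) _ t3 => /andP[{}ok _].
have [|||us_uniq kus] := chain0_sound (us := [:: x; u1; u2; u3]) ok.
+ rewrite /= -!/(vtype v1 v2 v3 v4 _) x_t !eqxx !(adj_sym _ x) xu1 xu2 xu3.
  by rewrite (adj_sym u2 u1) (adj_sym u3 u1) (adj_sym u3 u2) (negPf n12) (negPf n13) (negPf n23).
+ by rewrite /= o1 o2 o3.
+ by rewrite cons_uniq u_uniq !inE !negb_or x1 x2 x3.
exists (rev [:: x; u1; u2; u3]); split=> //.
by rewrite all_rev /all x_t !tNP.
Qed.

(** If no vertex has a type in [ts], the neighbours of [u] all see [w]. *)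
Lemma comparable_or u w (ts : seq bitseq) : u != w -> ~~ adj u w ->
  (forall y, adj u y -> ~~ adj w y -> vt y \in ts) -> good G \/ exists y, vt y \in ts.
Proof.
move=> uw nuw u_ts.
have [/existsP|/existsPn no_ts] := boolP [exists y, vt y \in ts]; first by right.
left; left; exists u, w; split=> //; apply/orP; left; apply/subsetP => y; rewrite !inE => uy.
by apply/negPn/negP => /(u_ts y uy); rewrite (negPf (no_ts y)).
Qed.

Lemma good_single_pendant : good G.
Proof.
have [x_deg|x_deg] := leqP (deg x) (omega G + 2); first by right; right; left; exists x.
have [D_cl|/not_clique_D[p [q [pq p_t q_t npq]]]] := boolP (clique (cls [:: tD])).
  (* As $A_3$ is empty, [v3] sees only $B_2+B_3$ outside the cycle and $D$. *)
  apply: (nice_of_deg (ts := [:: tB2; tB3]) D_cl (v := v3)).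
    move=> u /nbr_v3; rewrite !inE => /or4P[->|->|/eqP u_t|]; rewrite ?orbT //.
      by have := noA3 u; rewrite u_t.
    by case/orP=> ->; rewrite !orbT.
  rewrite leqNgt; apply/negP => /card_gt2P[u1 [u2 [u3 [[]]]]].
  rewrite !in_set => t1 t2 t3 [n12 n23 n31].
  have [s [s_uniq s_t]] := non_nice_ctx_sound x_deg three_far_refuted.
  move=> /allP/(_ _ t1)/allP/(_ _ t2)/allP/(_ _ t3) ok.
  have s_B u : vt u \in [:: tB2; tB3] -> u \notin s ++ bs.
    move=> u_t; rewrite mem_cat negb_or outer_notin_base ?andbT.
      by apply: contraL u_t => /(allP s_t); rewrite !inE => /or4P[] /eqP->.
    by move: u_t; rewrite !inE => /orP[] /eqP->.
  have /= : (fun _ : state => false) (mt (catrev [:: u1; u2; u3] s ++ bs)).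
    apply: (chain_sound (us := [:: u1; u2; u3]) ok).
    - by rewrite /= !eqxx.
    by rewrite /= !inE !negb_or s_uniq !s_B // (eq_sym u3) n23 n31 (eq_sym u2) n12.
  by [].
case/and4P: C4_chordless => n13 n24 a13 a24.
(* Among the inclusions between neighbourhoods of opposite cycle vertices, [x] rules out that of
   [v1] in [v3]; each other one gives comparable vertices or, failing, a vertex to seed the
   enumeration. *)
have [||y|//|[y3 y3_t]] := @comparable_or v3 v1 [:: tB2; tB3].
- by rewrite eq_sym.
- by rewrite adj_sym.
- have [-> _ -> _] := adj_sym_vtype y.
  have := @vtype_all (fun t => (t != tA3) ==> nth false t 2 ==> ~~ nth false t 0 ==>
    (t \in [:: tB2; tB3])) y isT.
  by rewrite noA3 implyTb => /implyP H /H/implyP.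
have [||y|//|[y4 y4_t]] := @comparable_or v4 v2 [:: tA4; tB3; tB4].
- by rewrite eq_sym.
- by rewrite adj_sym.
- have [_ -> _ ->] := adj_sym_vtype y.
  have := @vtype_all (fun t => nth false t 3 ==> ~~ nth false t 1 ==>
    (t \in [:: tA4; tB3; tB4])) y isT.
  by move=> /implyP H /H/implyP.
have [//|//|y|//|[y2 y2_t]] := @comparable_or v2 v4 [:: tA2; tB1; tB2].
  have [_ -> _ ->] := adj_sym_vtype y.
  have := @vtype_all (fun t => nth false t 1 ==> ~~ nth false t 3 ==>
    (t \in [:: tA2; tB1; tB2])) y isT.
  by move=> /implyP H /H/implyP.
have [s [s_uniq _ ok]] := non_nice_ctx_sound x_deg non_nice_colourable.
have {ok s_uniq} [s1 s_uniq ok] := extend_nonedge_sound G_free ok s_uniq tD_notin_base pq p_t q_t npq.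
have {ok s_uniq} [s2 s_uniq ok] := extend_some_sound G_free ok s_uniq y3_t.
have {ok s_uniq} [s3 s_uniq ok] := extend_some_sound G_free ok s_uniq y4_t.
have {ok s_uniq} [s4 s_uniq ok] := extend_some_sound G_free ok s_uniq y2_t.
have {ok s_uniq} [s5 [s_uniq ok s_all]] := extend_alls_sound G_free ok s_uniq.
apply: good_of_colours; apply: colours_of_leaf s_uniq ok _ => u u_t; apply: s_all.
have := @vtype_all (fun t => (t != tA3) ==> (t \in tB ++ [:: tA2; tA3; tA4]) ==>
  (t \in [:: tB2; tB3; tB4; tB1; tA4; tA2])) u isT.
by rewrite noA3 u_t.
Qed.

End Pendant.

Lemma good_pendant x : vt x = tA1 -> good G.
Proof.
move=> x_t; have [/existsP[y /eqP y_t]|/existsPn noA3] := boolP [exists y, vt y == tA3].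
  exact: (good_opposite_pendants x_t y_t).
exact: good_single_pendant x_t noA3.
Qed.

End FourCycle.

Theorem theorem3p3 (G : sgraph)
    (noP2P3 : ~ contains_induced G P2_P3)
    (noCoP2P3 : ~ contains_induced G (compl P2_P3))
    (noK23 : ~ contains_induced G (complete_bipartite 2 3))
    (hasBanner : contains_induced G banner) :
  good G.
Proof.
have [f f_inj f_adj] := hasBanner; pose v (i : nat) : G := f (Some (inord i)).
have vE i j : i < 4 -> j < 4 -> adj (v i) (v j) = (i.+1 %% 4 == j) || (j.+1 %% 4 == i).
  by move=> i4 j4; rewrite f_adj /= !inordK.
(* [f None] sees only [v 0] on the cycle, so its type is [tA1]. *)
apply: (@good_pendant G (bad5freeP noP2P3 noCoP2P3 noK23) (v 0) (v 1) (v 2) (v 3) _ _ (f None)).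
- by rewrite !vE.
- rewrite !vE // /v !(inj_eq f_inj) /= !andbT.
  by apply/andP; split; apply/eqP => -[/(congr1 val)]; rewrite /= !inordK.
by rewrite /vtype /= !f_adj /= -!val_eqE /= !inordK.
Qed.
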